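(* Let $(X,d,\mu)$ be a metric measure space and let $B_0$ be a fixed ball of radius $r_0$. Assume that the measure $\mu$ has a lower bound, that is, there exist constants $b,Q>0$ such that $\mu(B(x,r))\ge b r^Q$ whenever $B(x,r)\subset 2B_0$. Let $u\in \dot{M}^s_{p,q}(2B_0)$ and $\vec g=(g_j)_{j\in\mathbb{Z}}\in\mathbb{D}^s(u)$, where $0<p,q,s<\infty$. Then there exist constants $C,C_1,C_2$ and $C_3$ such that the following hold. 1. If $0<sp<Q$, then $u\in L^{p^*}(B_0)$, $p^*=\frac{Qp}{Q-sp}$, and $$\inf_{a\in\mathbb{R}}\left(\frac{1}{\mu(B_0)}\int_{B_0}|u-a|^{p^*}\,d\mu\right)^{\frac{1}{p^*}}\le C\left(\frac{\mu(2B_0)}{b r_0^Q}\right)^{1/p} r_0^{s}\left(\frac{1}{\mu(2B_0)}\int_{2B_0}\Big(\sum_{j=-\infty}^{\infty}g_j^q\Big)^{\frac{p}{q}}\,d\mu\right)^{\frac{1}{p}}.$$ 2. If $sp=Q$, then $$\frac{1}{\mu(B_0)}\int_{B_0}\exp\left(C_1 b^{1/Q}\,\frac{|u-u_{B_0}|}{\|\vec g\|_{L^p(2B_0,l^q)}}\right)d\mu\le C_2.$$ 3. If $sp>Q$, then $$\|u-u_{B_0}\|_{L^\infty(B_0)}\le C_3\left(\frac{\mu(2B_0)}{b r_0^Q}\right)^{1/p} r_0^{s}\left(\frac{1}{\mu(2B_0)}\int_{2B_0}\Big(\sum_{j=-\infty}^{\infty}g_j^q\Big)^{\frac{p}{q}}\,d\mu\right)^{\frac{1}{p}}.$$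 In particular, for $x,y\in B_0$, we have, with a constant $c$, $$|u(x)-u(y)|\le c\, b^{-1/p}\, d(x,y)^{1-s/p}\left(\frac{1}{\mu(2B_0)}\int_{2B_0}\Big(\sum_{j=-\infty}^{\infty}g_j^q\Big)^{\frac{p}{q}}\,d\mu\right)^{\frac{1}{p}}.$$
   Context: A metric measure space $(X,d,\mu)$ is a metric space $(X,d)$ equipped with a Borel regular measure $\mu$ on $X$ such that all balls defined by $d$ have finite and positive measure. $B(x,r)$ is the ball with center $x$ and radius $r$, and $2B_0$ is the ball with the same center as $B_0$ and twice its radius. $u_{B_0}=\frac{1}{\mu(B_0)}\int_{B_0}u\,d\mu$ is the integral average of $u$ over $B_0$. Let $S\subset X$ be a measurable set and let $0<s<\infty$. A sequence $(g_k)_{k\in\mathbb{Z}}$ of nonnegative measurable functions is a fractional $s$-gradient of a measurable function $u:S\to[-\infty,\infty]$ in $S$ if there exists a set $E\subset S$ with $\mu(E)=0$ such that $$|u(x)-u(y)|\le d(x,y)^s\big(g_k(x)+g_k(y)\big)$$ for all $k\in\mathbb{Z}$ and all $x,y\in S\setminus E$ satisfying $2^{k-1}\le d(x,y)<2^k$. The collection of all fractional $s$-gradients of $u$ is denoted by $\mathbb{D}^s(u)$; in the claim, $S=2B_0$. For $0<p,q<\infty$ and a sequence $\vec f=(f_k)_{k\in\mathbb{Z}}$ of measurable functions, put $$\|\vec f\|_{L^p(S,l^q)}=\left\|\Big(\sum_{k\in\mathbb{Z}}|f_k|^q\Big)^{1/q}\right\|_{L^p(S)}.$$ The homogeneous Hajłasz-Triebel-Lizorkin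 space $\dot M^s_{p,q}(S)$ consists of the measurable functions $u:S\to[-\infty,\infty]$ for which the (semi)norm $\|u\|_{\dot M^s_{p,q}(S)}=\inf_{\vec g\in\mathbb{D}^s(u)}\|\vec g\|_{L^p(S,l^q)}$ is finite.
   Formalization: In the last display the exponent 1-s/p (false as printed) is corrected to s-Q/p, x,y range off a null set, and c may depend on μ(2B_0); C_1 may depend on b, as scaling of μ forces; u is assumed finite a.e., which fails only if 2B_0 is a single point. *)

(* Defs.v *)
From HB Require Import structures.
From mathcomp Require Import all_boot all_order all_algebra.
From mathcomp Require Import all_classical all_reals all_analysis.
From mathcomp Require Import measurable_realfun ess_sup_inf metric_structure.

Set Implicit Arguments.
Unset Strict Implicit.
Unset Printing Implicit Defensive.

Import Order.TTheory GRing.Theory Num.Theory.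
Import numFieldNormedType.Exports.

Local Open Scope classical_set_scope.
Local Open Scope ring_scope.
Local Open Scope ereal_scope.

(* Pointedness is required by [caratheodory_type]; it only excludes the empty
   space, which contains no ball. *)
#[short(type="pointedMetricType")]
HB.structure Definition PointedMetric (K : numDomainType) :=
  {M of Metric K M & Pointed M}.

(* Borel regularity in the sense of outer measures: Borel sets are Caratheodory
   measurable and every set has a Borel hull of the same measure. *)
Definition borel_regular (R : realType) (X : pointedMetricType R)
    (mu : {outer_measure set X -> \bar R}) : Prop :=
  (forall B : set X, <<s [set U : set X | open U] >> B -> mu.-caratheodory B) /\
  (forall A : set X, exists B : set X,
    [/\ <<s [set U : set X | open U] >> B, A `<=` B & mu B = mu A]).

Definition metric_measure_space (R : realType) (X : pointedMetricType R)
    (mu : {outer_measure set X -> \bar R}) : Prop :=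
  borel_regular mu /\
  (forall (x : X) (r : R), (0 < r)%R -> 0 < mu (ball x r) < +oo).

(* [mu] as a measure on the sigma-algebra of its Caratheodory measurable sets. *)
Definition cara (R : realType) (X : pointedType)
    (mu : {outer_measure set X -> \bar R}) :
  {measure set (caratheodory_type mu) -> \bar R} := mu.

Section function_spaces.
Context (R : realType) (X : pointedMetricType R)
  (mu : {outer_measure set X -> \bar R}).

Definition mu_measurable (S : set X) (f : X -> \bar R) : Prop :=
  measurable_fun (S : set (caratheodory_type mu))
    (f : caratheodory_type mu -> \bar R).

Definition average (S : set X) (f : X -> \bar R) : \bar R :=
  (mu S)^-1 * \int[cara mu]_(x in S) f x.

(* [p : \bar R], so this covers L^infty(S) too: the extension by 0 changes
   neither the integral of |f|^p nor the essential supremum of |f| over S. *)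
Definition LnormS (p : \bar R) (S : set X) (f : X -> \bar R) : \bar R :=
  Lnorm (cara mu) p (f \_ S).

Definition LspaceS (p : \bar R) (S : set X) : set (X -> \bar R) :=
  [set f | mu_measurable S f /\ LnormS p S f < +oo].

Definition Llq_norm (p q : R) (S : set X) (f : int -> X -> \bar R) : \bar R :=
  LnormS p%:E S (fun x => (\esum_(k in [set: int]) `|f k x| `^ q) `^ q^-1).

(* In [\bar R] one has `|+oo - +oo| = +oo: where u is infinite the inequality
   forces g_k(x) + g_k(y) = +oo. *)
Definition fractional_gradients (s : R) (S : set X) (u : X -> \bar R) :
    set (int -> X -> \bar R) :=
  [set g | [/\ forall k, mu_measurable S (g k),
      forall k x, S x -> 0 <= g k x &
      exists E : set X, [/\ E `<=` S, mu E = 0 &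
        forall (k : int) (x y : X), (S `\` E) x -> (S `\` E) y ->
          ((2 : R) ^ (k - 1) <= mdist x y < (2 : R) ^ k)%R ->
          `|u x - u y| <= (mdist x y `^ s)%:E * (g k x + g k y)]]].

Definition hajlasz_TL_norm (s p q : R) (S : set X) (u : X -> \bar R) : \bar R :=
  ereal_inf [set Llq_norm p q S g | g in fractional_gradients s S u].

Definition hajlasz_TL (s p q : R) (S : set X) : set (X -> \bar R) :=
  [set u | mu_measurable S u /\ hajlasz_TL_norm s p q S u < +oo].

End function_spaces.

(* Main.v *)
Require Import Defs.
From HB Require Import structures.
From mathcomp Require Import all_boot all_order all_algebra.
From mathcomp Require Import all_classical all_reals all_analysis.
From mathcomp Require Import measurable_realfun ess_sup_inf metric_structure.
From mathcomp Require Import ring lra.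

Set Implicit Arguments.
Unset Strict Implicit.
Unset Printing Implicit Defensive.

Import Order.TTheory GRing.Theory Num.Theory.
Import numFieldNormedType.Exports.

(** Put G = (sum_k g_k^q)^(1/q) and let I be the integral of G^p over 2B_0.
Each g_k is at most G and every positive distance lies in one dyadic shell,
so off a null set |u(x) - u(y)| <= d(x,y)^s (G(x) + G(y)) for all pairs at
once ([exceptional_set]).  From here on only G and this inequality matter.

Let I <= A^p.  By Chebyshev's inequality {G > t} has mass at most (A/t)^p in
2B_0, so a ball of radius r inside 2B_0 with b r^Q > (A/t)^p contains a point
where G <= t ([chebyshev_abundant]).  From a point of B_0 where
G <= T 2^n one therefore walks to a point where G <= T, halving the bound on
G at each step, with steps of length proportional to 2^(-ip/Q) at level i.
The base height T is of order A (b r_0^Q)^(-1/p), chosen so that the steps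
sum to less than r_0 and the walk stays in 2B_0 ([chain_to_base]).
At level i the function u moves by at most a constant times
T r_0^s theta^i with theta = 2^(1 - sp/Q), and on {G <= T} its oscillation is
at most a constant times T r_0^s.  Hence, for some a,

  |u(x) - a| <= T r_0^s (const + 3 sum_(i < n) theta^i)  when G(x) <= T 2^n

([base_oscillation]).  The three regimes are the three behaviours of this
geometric sum.  With the least such n one has 2^(np) <= 1 + (2G/T)^p
([dyadic_level]), and the average of the right-hand side over B_0 is at most 2,
because (2A/T)^p <= b r_0^Q <= mu(B_0) ([weight_mass], [average_le_weight]).

- theta > 1: |u - a| is at most a multiple of theta^n, whose
  power of exponent Qp/(Q - sp) is 2^(np) ([subcritical_oscillation]).
- theta = 1: |u - a| is at most affine in n, so the exponential of a small
  multiple of it is at most a multiple of 2^(np) ([critical_oscillation]).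
- theta < 1: the sum is bounded, and so is |u - a|
  ([supercritical_oscillation]).  Hoelder continuity is this bound on the ball
  B(x, 2 d(x,y)) when 4 d(x,y) <= r_0, and on B_0 otherwise
  ([supercritical_holder]).

In the last two regimes a is replaced by u_{B_0}, which differs from a by at
most the average of |u - a| ([average_near]).  Since I^(1/p) may be 0 or
infinite, bounds linear in A are proved for all A > 0 with I <= A^p and then
passed to the infimum ([le_energy_root]). *)

Local Open Scope classical_set_scope.
Local Open Scope ring_scope.

(** * Dyadic scales *)

Section dyadic_scales.
Context {R : realType}.
Implicit Types (d h p t T x : R) (n : nat).

Lemma powR_nat_exp x p n : 0 <= x -> (x `^ p) ^+ n = (x ^+ n) `^ p.
Proof. by move=> x0; rewrite -(powR_mulrn n (powR_ge0 x p)) powRAC powR_mulrn. Qed.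

Lemma powRV x p : 0 <= x -> x^-1 `^ p = x `^ (- p).
Proof. by move=> x0; rewrite -(powR_inv1 x0) -powRrM mulN1r. Qed.

Lemma dyadic_shell d : 0 < d ->
  exists k : int, (2 : R) ^ (k - 1) <= d < (2 : R) ^ k.
Proof.
move=> d0; pose l := ln d / ln 2.
have ln2 : 0 < ln 2 :> R by rewrite ln_gt0// ltr1n.
have dE : d = 2 `^ l by rewrite /powR pnatr_eq0/= divfK ?lnK// gt_eqF.
exists (Num.floor l + 1); rewrite addrK {1 2}dE -!powR_intmul//.
have /andP[l1 l2] := floor_itv l; apply/andP; split.
  by rewrite ler_powR// ler1n.
by rewrite /powR pnatr_eq0/= ltr_expR ltr_pM2r.
Qed.

(** The least dyadic level of [h] above [T]: minimality gives [T 2^(n-1) < h]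
unless [n = 0], and the summand 1 covers that case. *)
Lemma dyadic_level p T h : 0 < p -> 0 < T -> 0 <= h ->
  exists n, h <= T * 2 ^+ n /\ (2 `^ p) ^+ n <= 1 + (2 * h / T) `^ p.
Proof.
move=> p0 T0 h0.
have ex : exists n, h <= T * 2 ^+ n.
  exists (Num.truncn (h / T)).+1.
  rewrite mulrC -ler_pdivrMr//.
  have : h / T < (Num.truncn (h / T)).+1%:R by rewrite truncnS_gt.
  move=> /ltW /le_trans; apply; rewrite -natrX ler_nat.
  exact/ltnW/ltn_expl.
case: (ex_minnP ex) => -[|n] hn nmin.
  by exists 0%N; split => //; rewrite expr0 lerDl powR_ge0.
exists n.+1; split => //; rewrite powR_nat_exp//.
have {nmin} : T * 2 ^+ n < h.
  by rewrite ltNge; apply/negP => /nmin; rewrite ltnn.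
move=> Th; rewrite ler_wpDl//; apply: ge0_ler_powR; rewrite ?nnegrE ?ltW//.
- by rewrite divr_gt0// mulr_gt0// (le_lt_trans _ Th)// mulr_ge0 ?exprn_ge0 ?ltW.
- by rewrite ltr_pdivlMr// exprS -mulrA ltr_pM2l// mulrC.
Qed.

End dyadic_scales.

(** * Chains through the sublevel sets of a gradient *)

Section chains.
Context {R : realType} {X : metricType R}.
Implicit Types (B D : set X) (v h : X -> R).

Definition pointwise_gradient (s : R) D v h := forall x y, D x -> D y ->
  `|v x - v y| <= mdist x y `^ s * (h x + h y).

(** The only consequence of the lower mass bound and of the integrability of the
gradient that the chaining argument uses. *)
Definition abundant_sublevels (b Q A p : R) B D h := forall x r t,
  0 < r -> 0 < t -> ball x r `<=` B -> (A / t) `^ p < b * r `^ Q ->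
  exists y, [/\ D y, ball x r y & h y <= t].

(** Raising the height of the sublevel set by a factor 2 divides the Chebyshev
mass [(A / t)^p] by [2^p], hence the radius that beats it by [2^(p/Q)]. *)
Definition chain_ratio (p Q : R) : R := 2 `^ (- (p / Q)).

(** From one level to the next the bound on the gradient doubles while the
factor [r^s] shrinks; this is the resulting ratio of the increments of [v]. *)
Definition chain_growth (p s Q : R) : R := 2 * chain_ratio p Q `^ s.

(** The step radii are [(1 - delta) r0 delta^i], which sum to [r0].  Without the
factor 2 the mass [(A / T)^p] would equal [b r^Q] for the first radius [r];
with it the inequality is strict. *)
Definition base_height (p Q b r0 A : R) : R :=
  2 * A * (b * ((1 - chain_ratio p Q) * r0) `^ Q) `^ (- p^-1).

(** The factor of [base_height] that depends on the exponents alone, as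
[base_height_scale] shows. *)
Definition scale_factor (p Q : R) : R :=
  2 * (1 - chain_ratio p Q) `^ (- (Q / p)).

(** The first term pays for comparing two points of the doubled ball, whose
diameter is at most [4 r0].  The second bounds the geometric sum: by a constant
if [theta < 1], by a multiple of its next power [theta^n] if [theta > 1]. *)
Definition oscillation_factor (p s Q : R) : R :=
  2 * 4 `^ s + 3 / `|chain_growth p s Q - 1|.

Context (p s Q b r0 A : R) (x0 : X) (D : set X) (v h : X -> R).
Hypotheses (p0 : 0 < p) (s0 : 0 < s) (Q0 : 0 < Q) (b0 : 0 < b)
  (r00 : 0 < r0) (A0 : 0 < A).

Local Notation delta := (chain_ratio p Q).
Local Notation theta := (chain_growth p s Q).
Local Notation T := (base_height p Q b r0 A).

Lemma chain_ratio_gt0 : 0 < delta.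
Proof. exact: powR_gt0. Qed.

Lemma chain_ratio_lt1 : delta < 1.
Proof.
rewrite /chain_ratio powRN invf_lt1 ?powR_gt0// /powR pnatr_eq0/= expR_gt1.
by rewrite mulr_gt0 ?divr_gt0 ?ln_gt0 ?ltr1n.
Qed.

Lemma base_height_gt0 : 0 < T.
Proof.
by rewrite !mulr_gt0// powR_gt0// mulr_gt0// powR_gt0// mulr_gt0// subr_gt0
  chain_ratio_lt1.
Qed.

Lemma chain_ratio_powR : delta `^ Q = 2^-1 `^ p.
Proof.
by rewrite -powRrM mulNr divfK ?gt_eqF// powRV.
Qed.

Lemma base_height_mass :
  (A / T) `^ p = 2^-1 `^ p * (b * ((1 - delta) * r0) `^ Q).
Proof.
set m := b * _; have m0 : 0 < m.
  by rewrite mulr_gt0// powR_gt0// mulr_gt0// subr_gt0 chain_ratio_lt1.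
have -> : A / T = 2^-1 * m `^ p^-1.
  rewrite /base_height -/m powRN; field.
  by rewrite !gt_eqF// powR_gt0.
by rewrite powRM ?invr_ge0 ?powR_ge0// -powRrM mulVf ?gt_eqF// powRr1// ltW.
Qed.

Lemma chain_radius_mass n :
  (A / (T * 2 ^+ n)) `^ p < b * ((1 - delta) * r0 * delta ^+ n) `^ Q.
Proof.
have T0 := base_height_gt0; have d0 := chain_ratio_gt0.
have d1 : 0 < 1 - delta by rewrite subr_gt0 chain_ratio_lt1.
have -> : A / (T * 2 ^+ n) = A / T * (2^-1) ^+ n.
  by rewrite exprVn invfM mulrA.
rewrite powRM ?exprn_ge0 ?divr_ge0 ?ltW// base_height_mass.
rewrite [X in _ < b * X]powRM ?exprn_ge0 ?mulr_ge0 ?ltW//.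
rewrite -!powR_nat_exp ?ltW// chain_ratio_powR.
rewrite [ltRHS]mulrA ltr_pM2r; last by rewrite exprn_gt0// powR_gt0.
rewrite gtr_pMl; last by rewrite mulr_gt0// powR_gt0// mulr_gt0.
apply: (@lt_le_trans _ _ (1 `^ p)); last by rewrite powR1.
by apply: gt0_ltr_powR; rewrite ?nnegrE ?invr_ge0 ?invf_lt1 ?ltr1n.
Qed.

Lemma chain_growthE : theta = 2 `^ (1 - s * p / Q).
Proof.
rewrite /chain_growth /chain_ratio -powRrM -{1}[2]powRr1// -powRD.
  by congr powR; field; rewrite gt_eqF.
by rewrite pnatr_eq0 implybT.
Qed.

Lemma base_height_scale : T * r0 `^ s =
  scale_factor p Q * (b * r0 `^ Q) `^ (- p^-1) * r0 `^ s * A.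
Proof.
have d1 : 0 < 1 - delta by rewrite subr_gt0 chain_ratio_lt1.
have d10 := mulr_ge0 (ltW d1) (ltW r00).
rewrite /scale_factor /base_height !(powRM _ (ltW b0) (powR_ge0 _ _)) -!powRrM.
by rewrite (powRM _ (ltW d1) (ltW r00)) !mulrN; ring.
Qed.

Lemma chain_growthX n :
  (delta ^+ n) `^ s * 2 ^+ n = theta ^+ n.
Proof.
by rewrite -powR_nat_exp ?ltW ?chain_ratio_gt0// -exprMn mulrC.
Qed.

Hypothesis gradvh : pointwise_gradient s D v h.
Hypothesis sublevels : abundant_sublevels b Q A p (ball x0 (2 * r0)) D h.

(** The steps from level [n] down to level 0 have total length
[r0 (1 - delta^n)], so the distance hypothesis is exactly what keeps the walk
in the doubled ball; it is preserved by each step. *)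
Lemma chain_to_base n x : D x -> h x <= T * 2 ^+ n ->
  mdist x0 x + r0 * (1 - delta ^+ n) <= 2 * r0 ->
  exists y, [/\ D y, h y <= T &
    `|v x - v y| <= 3 * T * r0 `^ s * \sum_(i < n) theta ^+ i].
Proof.
have T0 := base_height_gt0; have d0 := chain_ratio_gt0.
have d1 : 0 < 1 - delta by rewrite subr_gt0 chain_ratio_lt1.
elim: n x => [|n IH] x Dx hx x0x.
  by exists x; rewrite big_ord0 mulr0 subrr normr0 -[T]mulr1.
have [||||y [Dy xy hy]] := sublevels (x := x)
  (r := (1 - delta) * r0 * delta ^+ n) (t := T * 2 ^+ n).
- by rewrite !mulr_gt0// exprn_gt0.
- by rewrite mulr_gt0// exprn_gt0.
- move=> z; rewrite !ballEmdist/= => xz.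
  apply: le_lt_trans (metric_triangle _ x _) _.
  apply: lt_le_trans x0x; rewrite ltrD2l; apply: lt_le_trans xz _.
  rewrite -mulrA mulrCA ler_wpM2l ?(ltW r00)// exprS mulrBl mul1r lerD2r.
  by rewrite exprn_ile1// ltW// chain_ratio_lt1.
- exact: chain_radius_mass.
move: xy; rewrite ballEmdist/= => xy.
have [|z [Dz hz yz]] := IH y Dy hy.
  apply: le_trans x0x; apply: le_trans (lerD (metric_triangle _ x _) (lexx _)) _.
  rewrite -addrA lerD2l; apply: le_trans (lerD (ltW xy) (lexx _)) _.
  by rewrite le_eqVlt exprS; apply/orP; left; apply/eqP; ring.
exists z; split => //; apply: le_trans (ler_distD (v y) _ _) _.
rewrite big_ord_recr/= mulrDr addrC lerD//.
apply: le_trans (gradvh Dx Dy) _.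
have -> : 3 * T * r0 `^ s * theta ^+ n =
    (r0 * delta ^+ n) `^ s * (T * 2 ^+ n.+1 + T * 2 ^+ n).
  rewrite powRM ?ltW ?exprn_gt0// -chain_growthX exprS; ring.
apply: (@le_trans _ _ (mdist x y `^ s * (T * 2 ^+ n.+1 + T * 2 ^+ n))).
  by rewrite ler_wpM2l ?powR_ge0// lerD.
rewrite ler_wpM2r//.
  by rewrite addr_ge0 ?(mulr_ge0 (ltW T0)) ?exprn_ge0.
apply: ge0_ler_powR; rewrite ?nnegrE ?mdist_ge0 ?(ltW s0)//.
  by rewrite mulr_ge0 ?exprn_ge0 ?(ltW r00) ?(ltW d0).
apply: ltW; apply: lt_le_trans xy _; rewrite -mulrA ler_piMl ?gerBl ?(ltW d0)//.
by rewrite mulr_ge0 ?exprn_ge0 ?(ltW r00) ?(ltW d0).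
Qed.

Hypothesis subD : D `<=` ball x0 (2 * r0).
Hypothesis h0 : forall x, D x -> 0 <= h x.

(** Walk from [x] to a point of height at most [T], then compare with a fixed
point of height at most [T]; the two lie at distance less than [4 r0]. *)
Lemma base_oscillation : exists a, forall x n, D x -> ball x0 r0 x ->
  h x <= T * 2 ^+ n ->
  `|v x - a| <= T * r0 `^ s * (2 * 4 `^ s + 3 * \sum_(i < n) theta ^+ i).
Proof.
have T0 := base_height_gt0; have d0 := chain_ratio_gt0.
have d1 : 0 < 1 - delta by rewrite subr_gt0 chain_ratio_lt1.
have [||||y0 [Dy0 _ hy0]] := sublevels (x := x0)
  (r := (1 - delta) * r0 * delta ^+ 0) (t := T * 2 ^+ 0).
- by rewrite !mulr_gt0.
- by rewrite mulr_gt0.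
- apply: le_ball; rewrite expr0 mulr1 ler_pM2r//.
  by rewrite lerBlDr (le_trans (_ : 1 <= 2))// ?ler1n// lerDl ltW.
- exact: chain_radius_mass.
exists (v y0) => x n Dx; rewrite ballEmdist/= => xB hx.
have [|y [Dy hy xy]] := chain_to_base Dx hx.
  have : r0 * delta ^+ n >= 0.
    by rewrite mulr_ge0 ?exprn_ge0 ?(ltW r00) ?(ltW d0).
  by rewrite mulrBr mulr1; move: xB; lra.
apply: le_trans (ler_distD (v y) _ _) _.
rewrite addrC mulrDr; apply: lerD; last first.
  by apply: le_trans xy _; rewrite mulrA [T * _ * 3]mulrAC [T * 3]mulrC.
apply: le_trans (gradvh Dy Dy0) _.
rewrite expr0 mulr1 in hy0.
have -> : T * r0 `^ s * (2 * 4 `^ s) = (4 * r0) `^ s * (T + T).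
  by rewrite powRM ?(ltW r00)//; ring.
apply: (@le_trans _ _ (mdist y y0 `^ s * (T + T))).
  by rewrite ler_wpM2l ?powR_ge0// lerD.
rewrite ler_wpM2r ?addr_ge0 ?(ltW T0)//.
apply: ge0_ler_powR; rewrite ?nnegrE ?mdist_ge0 ?mulr_ge0 ?(ltW s0) ?(ltW r00)//.
move: (subD Dy) (subD Dy0); rewrite ballEmdist/= => yB y0B.
apply: le_trans (metric_triangle _ x0 _) _.
by rewrite [mdist y x0]metric_sym; lra.
Qed.

(** Here the ratio of the increments is less than 1, and the geometric series
bounds all partial sums at once. *)
Lemma supercritical_oscillation : Q < s * p -> exists a, forall x,
  D x -> ball x0 r0 x ->
  `|v x - a| <= T * r0 `^ s * oscillation_factor p s Q.
Proof.
move=> sp; have [a av] := base_oscillation; exists a => x Dx Bx.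
have T0 := base_height_gt0.
have [n [hx _]] := dyadic_level p0 T0 (h0 Dx).
apply: le_trans (av x n Dx Bx hx) _.
apply: (ler_wpM2l (mulr_ge0 (ltW T0) (powR_ge0 _ _))).
have t1 : theta < 1.
  rewrite chain_growthE -[ltRHS](powRr0 2) /powR pnatr_eq0/= ltr_expR.
  by rewrite ltr_pM2r ?ln_gt0 ?ltr1n// subr_lt0 ltr_pdivlMr// mul1r.
rewrite /oscillation_factor lerD2l ler_wpM2l// ltr0_norm ?subr_lt0// opprB.
rewrite -[leRHS]mul1r ler_pdivlMr ?subr_gt0//.
have := subrX1 theta n.
have : 0 <= theta ^+ n by rewrite exprn_ge0// mulr_ge0 ?powR_ge0.
by rewrite mulrC; nra.
Qed.

(** All increments are equal, so the oscillation grows linearly with the level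
while the measure of the level sets decays exponentially; the constant
[p ln 2 / 3] makes each increment contribute a factor [2^p]. *)
Lemma critical_oscillation : s * p = Q -> exists a, forall x,
  D x -> ball x0 r0 x ->
  expR (p * ln 2 / 3 * (`|v x - a| / (T * r0 `^ s))) <=
  expR (p * ln 2 / 3 * (2 * 4 `^ s)) * (1 + (2 * h x / T) `^ p).
Proof.
move=> sp; have [a av] := base_oscillation; exists a => x Dx Bx.
have T0 := base_height_gt0.
have l2 : 0 < ln 2 :> R by rewrite ln_gt0 ?ltr1n.
have [n [hx hn]] := dyadic_level p0 T0 (h0 Dx).
apply: le_trans (ler_wpM2l (expR_ge0 _) hn).
have -> : (2 `^ p) ^+ n = expR (p * ln 2 / 3 * (3 * n%:R)).
  by rewrite /powR pnatr_eq0/= -expRM_natl; congr expR; field.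
rewrite -expRD ler_expR -mulrDr ler_pM2l ?divr_gt0 ?mulr_gt0//.
rewrite ler_pdivrMr ?(mulr_gt0 T0) ?powR_gt0//.
apply: le_trans (av x n Dx Bx hx) _; rewrite mulrC.
rewrite chain_growthE sp divff ?gt_eqF// subrr powRr0.
under eq_bigr do rewrite expr1n.
by rewrite sumr_const card_ord.
Qed.

(** The geometric sum is dominated by its last power, and the Sobolev exponent
is the one that turns [theta] into [2^p]. *)
Lemma subcritical_oscillation : s * p < Q -> exists a, forall x,
  D x -> ball x0 r0 x -> exists n, [/\ 1 <= theta ^+ n,
    `|v x - a| <= T * r0 `^ s * oscillation_factor p s Q * theta ^+ n &
    (theta ^+ n) `^ (Q * p / (Q - s * p)) <= 1 + (2 * h x / T) `^ p].
Proof.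
move=> sp; have [a av] := base_oscillation; exists a => x Dx Bx.
have T0 := base_height_gt0.
have [n [hx hn]] := dyadic_level p0 T0 (h0 Dx).
have t1 : 1 < theta.
  rewrite chain_growthE -[ltLHS](powRr0 2) /powR pnatr_eq0/= ltr_expR.
  by rewrite ltr_pM2r ?ln_gt0 ?ltr1n// subr_gt0 ltr_pdivrMr// mul1r.
have tn1 : 1 <= theta ^+ n by rewrite exprn_ege1// ltW.
exists n; split => //.
  apply: le_trans (av x n Dx Bx hx) _.
  rewrite /oscillation_factor gtr0_norm ?subr_gt0// -[leRHS]mulrA.
  apply: (ler_wpM2l (mulr_ge0 (ltW T0) (powR_ge0 _ _))).
  rewrite [leRHS]mulrDl; apply: lerD.
    by rewrite ler_peMr// mulr_ge0 ?powR_ge0.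
  rewrite -mulrA ler_wpM2l// mulrC ler_pdivlMr ?subr_gt0// mulrC -subrX1.
  by rewrite gerBl.
apply: le_trans hn; rewrite -powR_nat_exp ?(le_trans ler01 (ltW t1))//.
rewrite chain_growthE -powRrM le_eqVlt; apply/orP; left; apply/eqP.
congr (_ ^+ n); congr powR; field.
by rewrite !gt_eqF// subr_gt0.
Qed.

End chains.

(** * Caratheodory measurability *)

Section caratheodory.
Context {R : realType} {X : pointedMetricType R}
  {mu : {outer_measure set X -> \bar R}}.
Local Open Scope ereal_scope.

Lemma open_metric_ball (x : X) (r : R) : open (ball x r).
Proof.
rewrite openE => y; rewrite ballEmdist/= => xy.
have rxy : (0 < r - mdist x y)%R by rewrite subr_gt0.
apply/nbhs_ballP; exists (r - mdist x y)%R => //= z.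
rewrite !ballEmdist/= => yz; apply: le_lt_trans (metric_triangle _ y _) _.
by rewrite -ltrBrDl.
Qed.

Lemma measurable_metric_ball (x : X) (r : R) :
  metric_measure_space mu -> mu.-cara.-measurable (ball x r).
Proof.
by move=> [[+ _] _]; apply; apply: sub_sigma_algebra; exact: open_metric_ball.
Qed.

Lemma null_measurable (N : set X) : mu N = 0 -> mu.-cara.-measurable N.
Proof.
move=> N0; apply: le_caratheodory_measurable => Y.
have -> : mu (Y `&` N) = 0.
  by apply/eqP; rewrite eq_le outer_measure_ge0 andbT -N0 le_outer_measure.
by rewrite add0e le_outer_measure//; apply: subIset; left.
Qed.

Lemma null_setU (N1 N2 : set X) : mu N1 = 0 -> mu N2 = 0 -> mu (N1 `|` N2) = 0.
Proof.
move=> N10 N20; apply/eqP; rewrite eq_le outer_measure_ge0 andbT.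
by rewrite (le_trans (outer_measureU2 mu N1 N2))// N10 N20 adde0.
Qed.

Lemma ae_outside (N : set X) (P : X -> Prop) :
  mu N = 0 -> (forall x, ~ N x -> P x) -> {ae cara mu, forall x, P x}.
Proof.
move=> N0 NP; exists N; split => //; first exact: null_measurable.
by move=> x /= nP; apply: contrapT => /NP.
Qed.

(** A countable index type embeds in [nat] by [pickle]; extending the family by
0 outside the image turns the sum into a series. *)
Lemma measurable_esum (K : countType) (S : set X) (f : K -> X -> \bar R) :
  (forall k, mu_measurable mu S (f k)) -> (forall k x, S x -> 0 <= f k x) ->
  mu_measurable mu S (fun x => \esum_(k in [set: K]) f k x).
Proof.
move=> mf f0.
pose h n x :=
  if n \in range (@pickle K) then oapp (f ^~ x) 0 (unpickle n) else 0.
have h0 n x : S x -> 0 <= h n x.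
  by move=> Sx; rewrite /h; case: ifP => // _; case: unpickle => //= k; exact: f0.
apply: (@eq_measurable_fun _ _ (caratheodory_type mu) _ S
    (fun x => \sum_(n <oo | n \in xpredT) h n x)).
  move=> x /set_mem Sx; rewrite -[LHS]/(\sum_(n <oo | true) h n x).
  rewrite nneseries_esumT => [|n]; last exact: h0.
  rewrite -esum_mkcond (@reindex_esum _ _ _ [set: K] _ pickle).
    by apply: eq_esum => k _; rewrite pickleK.
  split=> [k _|k1 k2 _ _|n]; [by exists k|exact: (pcan_inj pickleK)|by []].
apply: ge0_emeasurable_sum => [n x Sx _|n _]; first exact: h0.
rewrite /h; case: (n \in _) => //; case: (unpickle n) => //= k; exact: mf.
Qed.

End caratheodory.

(** * The density of the mixed norm *)

Section lq_density.
Context {R : realType} {X : pointedMetricType R}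
  {mu : {outer_measure set X -> \bar R}}.
Implicit Types (p q s : R) (S : set X) (u : X -> \bar R) (g : int -> X -> \bar R).
Local Open Scope ereal_scope.

(** The p-th power of the pointwise l^q norm of a nonnegative sequence. *)
Definition lq_density p q g (x : X) : \bar R :=
  (\esum_(j in [set: int]) g j x `^ q) `^ (p / q).

Lemma lq_density_ge0 p q g x : 0 <= lq_density p q g x.
Proof. exact: poweR_ge0. Qed.

Lemma measurable_lq_density p q S g : (forall k, mu_measurable mu S (g k)) ->
  mu_measurable mu S (lq_density p q g).
Proof.
move=> mg; apply: (measurableT_comp (measurable_poweR _)).
apply: measurable_esum => [k|k x _]; last exact: poweR_ge0.
exact: (measurableT_comp (measurable_poweR q) (mg k)).
Qed.

Lemma coordinate_le_lq_density p q g k x : (0 < p)%R -> (0 < q)%R ->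
  0 <= g k x -> g k x <= lq_density p q g x `^ p^-1.
Proof.
move=> p0 q0 g0; rewrite /lq_density -poweRrM mulrAC divff ?gt_eqF// mul1r.
have -> : g k x = (g k x `^ q) `^ q^-1.
  by rewrite -poweRrM divff ?gt_eqF// poweRe1.
have sum0 : 0 <= \esum_(j in [set: int]) g j x `^ q.
  by apply: esum_ge0 => j _; exact: poweR_ge0.
apply: gt0_ler_poweR; rewrite ?invr_ge0 ?(ltW q0) ?in_itv/= ?poweR_ge0 ?leey ?sum0//.
apply: esum_ge; exists [set k]; first by split.
by rewrite fsbig_set1.
Qed.

Lemma LnormS_integral p S f : p != 0%R ->
  LnormS mu p%:E S f = (\int[cara mu]_(x in S) `|f x| `^ p) `^ p^-1.
Proof.
move=> p0; rewrite /LnormS unlock; congr poweR.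
rewrite [RHS]integral_mkcond; apply: eq_integral => x _.
by rewrite !patchE; case: ifPn => // _; rewrite abse0 poweR0r.
Qed.

Lemma Llq_norm_density p q S g : (0 < p)%R -> (0 < q)%R ->
  (forall k x, S x -> 0 <= g k x) ->
  Llq_norm mu p q S g = (\int[cara mu]_(x in S) lq_density p q g x) `^ p^-1.
Proof.
move=> p0 q0 g0; rewrite /Llq_norm LnormS_integral ?gt_eqF//; congr poweR.
apply: eq_integral => x /set_mem Sx.
rewrite gee0_abs ?poweR_ge0// -poweRrM mulrC /lq_density.
by congr poweR; apply: eq_esum => k _; rewrite gee0_abs ?g0.
Qed.

(** The pointwise l^q norm, as a real-valued function. *)
Definition gradient_height p q g (x : X) : R := fine (lq_density p q g x `^ p^-1).

Lemma gradient_height_ge0 p q g x : (0 <= gradient_height p q g x)%R.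
Proof. by rewrite fine_ge0// poweR_ge0. Qed.

Lemma gradient_height_powR p q g x : (0 < p)%R ->
  (gradient_height p q g x `^ p)%R = fine (lq_density p q g x).
Proof.
move=> p0; rewrite /gradient_height fine_poweR -powRrM mulVf ?gt_eqF//.
by rewrite powRr1// fine_ge0// lq_density_ge0.
Qed.

(** A pair of distinct points lies in a single dyadic shell, where the single
gradient [g k] is dominated by the l^q norm of the whole sequence. *)
Lemma exceptional_set p q s S u g : (0 < p)%R -> (0 < q)%R ->
  mu.-cara.-measurable S ->
  {ae cara mu, forall x, S x -> u x \is a fin_num} ->
  fractional_gradients mu s S u g ->
  \int[cara mu]_(x in S) lq_density p q g x < +oo ->
  exists N : set X, [/\ mu N = 0,
    forall x, S x -> ~ N x -> u x \is a fin_num,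
    forall x, S x -> ~ N x -> lq_density p q g x \is a fin_num &
    pointwise_gradient s (S `\` N) (fine \o u) (gradient_height p q g)].
Proof.
move=> p0 q0 mS [N1 [_ N10 uN1]] [mg g0 [E [_ E0 gradE]]] Wfin.
have iW : (cara mu).-integrable S (lq_density p q g).
  apply/integrableP; split; first exact: measurable_lq_density.
  by under eq_integral do rewrite gee0_abs ?lq_density_ge0//.
have [N2 [_ N20 WN2]] := integrable_ae mS iW.
exists (N1 `|` (N2 `|` E)); split.
- by do 2 (apply: null_setU => //).
- by move=> x Sx Nx; apply: contrapT => ux; apply: Nx; left; apply: uN1 => /(_ Sx).
- move=> x Sx Nx; apply: contrapT => ux; apply: Nx; right; left.
  by apply: WN2 => /(_ Sx).
move=> x y [Sx Nx] [Sy Ny]; have [->|xy] := eqVneq x y.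
  by rewrite subrr normr0 mulr_ge0 ?powR_ge0// addr_ge0// gradient_height_ge0.
have fin z : S z -> ~ (N1 `|` (N2 `|` E)) z ->
    [/\ u z \is a fin_num, lq_density p q g z \is a fin_num & ~ E z].
  move=> Sz Nz; split.
  - by apply: contrapT => uz; apply: Nz; left; apply: uN1 => /(_ Sz).
  - by apply: contrapT => uz; apply: Nz; right; left; apply: WN2 => /(_ Sz).
  - by move=> Ez; apply: Nz; right; right.
have [ux Wx Ex] := fin x Sx Nx; have [uy Wy Ey] := fin y Sy Ny.
have [k xyk] : exists k : int, ((2 : R) ^ (k - 1) <= mdist x y < (2 : R) ^ k)%R.
  by apply: dyadic_shell; rewrite mdist_gt0.
have := gradE k x y (conj Sx Ex) (conj Sy Ey) xyk.
move=> /le_trans/(_ (lee_wpmul2l _ (leeD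
  (coordinate_le_lq_density p0 q0 (g0 k x Sx))
  (coordinate_le_lq_density p0 q0 (g0 k y Sy))))).
rewrite lee_fin powR_ge0 => /(_ isT).
rewrite -(fineK ux) -(fineK uy) /=.
rewrite -[lq_density p q g x `^ _]fineK ?(fin_num_poweR _ Wx)//.
by rewrite -[lq_density p q g y `^ _]fineK ?(fin_num_poweR _ Wy).
Qed.

(** If the ball contained no such point, it would lie, up to the null set, in
[{G > t}], whose mass is at most [(A / t)^p]. *)
Lemma chebyshev_abundant p q b Q A S N g :
  (0 < p)%R -> (0 < A)%R -> mu.-cara.-measurable S ->
  (forall k, mu_measurable mu S (g k)) ->
  (forall (x : X) (r : R), (0 < r)%R -> ball x r `<=` S ->
     (b * r `^ Q)%:E <= mu (ball x r)) ->
  mu N = 0 -> (forall x, S x -> ~ N x -> lq_density p q g x \is a fin_num) ->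
  \int[cara mu]_(x in S) lq_density p q g x <= (A `^ p)%:E ->
  abundant_sublevels b Q A p S (S `\` N) (gradient_height p q g).
Proof.
move=> p0 A0 mS mg low N0 Wfin WA x r t r0 t0 xrS Atr.
apply: contrapT => none.
have tp0 : (0 < t `^ p)%R by exact: powR_gt0.
have mW := measurable_lq_density p q mg.
have := le_integral_abse (cara mu) mS mW tp0.
under [X in _ <= X -> _]eq_integral do rewrite gee0_abs ?lq_density_ge0//.
move=> /le_trans/(_ WA); set L := _ `&` _ => LA.
have bL : ball x r `<=` N `|` L.
  move=> y xy; apply: contrapT => NLy; apply: none; exists y.
  have Sy := xrS _ xy; have Ny : ~ N y by move=> Ny; apply: NLy; left.
  split=> //; rewrite leNgt; apply/negP => ty; apply: NLy; right; split => //=.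
  rewrite gee0_abs ?lq_density_ge0// -(fineK (Wfin y Sy Ny)) lee_fin.
  rewrite -gradient_height_powR//; apply: ge0_ler_powR; rewrite ?nnegrE ?(ltW p0)//.
  - exact: ltW.
  - exact: gradient_height_ge0.
  - exact: ltW.
have : mu (ball x r) <= mu L.
  apply: le_trans (le_outer_measure mu _ _ bL) _.
  by apply: le_trans (outer_measureU2 mu N L) _; rewrite N0 add0e.
move=> /(le_trans (low x r r0 xrS)) bLr.
have : (t `^ p * (b * r `^ Q))%:E <= (A `^ p)%:E.
  apply: le_trans LA; rewrite EFinM.
  by apply: lee_wpmul2l => //; rewrite lee_fin powR_ge0.
rewrite lee_fin leNgt => /negP; apply.
move: Atr; rewrite powRM ?invr_ge0 ?(ltW A0) ?(ltW t0)//.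
by rewrite (powRV _ (ltW t0)) powRN ltr_pdivrMr// mulrC.
Qed.

End lq_density.

(** * Averages *)

Lemma measurable_expeR (R : realType) : measurable_fun [set: \bar R] (@expeR R).
Proof.
have -> : @expeR R = fun x => if x == +oo%E then +oo%E else
    if x == -oo%E then 0%E else (expR (fine x))%:E.
  by apply/funext => -[].
apply: measurable_fun_ifT => //=; first exact: measurable_fun_eqe.
apply: measurable_fun_ifT => //=; first exact: measurable_fun_eqe.
exact/measurable_EFinP/(@measurableT_comp _ _ _ _ _ _ (@expR R)).
Qed.

Section averages.
Context {R : realType} {X : pointedMetricType R}
  {mu : {outer_measure set X -> \bar R}}.
Implicit Types (S B : set X) (u f W : X -> \bar R).
Local Open Scope ereal_scope.

(** By [c I <= mu B] the function [c W] has average at most 1 over [B], as has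
the constant 1. *)
Lemma average_le_density S B f W (I c M : R) :
  mu.-cara.-measurable S -> mu.-cara.-measurable B -> B `<=` S ->
  0 < mu B < +oo -> mu_measurable mu B f -> mu_measurable mu S W ->
  (forall x, B x -> 0 <= f x) -> (forall x, S x -> 0 <= W x) ->
  \int[cara mu]_(x in S) W x <= I%:E -> (0 <= c)%R -> (0 <= M)%R ->
  (c * I)%:E <= mu B ->
  {ae cara mu, forall x, B x -> f x <= M%:E * (1 + c%:E * W x)} ->
  average mu B f <= (2 * M)%:E.
Proof.
move=> mS mB BS /andP[muBgt0 muBoo] mf mW f0 W0 WI c0 M0 cI fW.
have muBfin : mu B \is a fin_num by rewrite ge0_fin_numE// ltW.
have m0 : (0 < fine (mu B))%R by rewrite fine_gt0// muBgt0.
rewrite /average -(fineK muBfin) inver gt_eqF// lee_pdivrMl//.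
have mWB : mu_measurable mu B W by apply: measurable_funS mW.
have mcW : mu_measurable mu B (fun x => c%:E * W x).
  exact: measurable_funeM.
have cW0 x : B x -> 0 <= c%:E * W x.
  by move=> Bx; rewrite mule_ge0// W0//; exact: BS.
apply: (@le_trans _ _ (\int[cara mu]_(x in B) (M%:E * (1 + c%:E * W x)))).
  apply: ae_ge0_le_integral => //.
    by move=> x Bx; rewrite mule_ge0// adde_ge0// cW0.
  by apply: measurable_funeM; apply: emeasurable_funD.
rewrite ge0_integralZl//; last 2 first.
- by apply: emeasurable_funD.
- by move=> x Bx; rewrite adde_ge0// cW0.
rewrite ge0_integralD// integral_cst// mul1e ge0_integralZl//; last first.
  by move=> x Bx; rewrite W0//; exact: BS.
have WB : \int[cara mu]_(x in B) W x <= I%:E.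
  by apply: le_trans WI; apply: ge0_subset_integral.
rewrite -[cara mu B]/(mu B) -(fineK muBfin).
have -> : ((fine (fine (mu B))%:E)%:E * (2 * M)%:E =
    M%:E * ((fine (mu B))%:E + (fine (mu B))%:E)).
  by rewrite -EFinD -!EFinM; congr EFin => /=; ring.
apply: lee_wpmul2l; rewrite ?lee_fin// leeD// fineK//.
by apply: le_trans cI; rewrite EFinM; apply: lee_wpmul2l.
Qed.

(** The hypothesis makes [u - a] integrable, and a constant is integrable on
[S] because [S] has finite mass. *)
Lemma average_near S u (a M : R) :
  mu.-cara.-measurable S -> 0 < mu S < +oo -> mu_measurable mu S u ->
  average mu S (fun x => `|u x - a%:E|) <= M%:E ->
  exists2 m : R, average mu S u = m%:E & (`|m - a| <= M)%R.
Proof.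
move=> mS /andP[muS0 muSoo] mf.
have muSfin : mu S \is a fin_num by rewrite ge0_fin_numE// ltW.
have m0 : (0 < fine (mu S))%R by rewrite fine_gt0// muS0.
rewrite /average -(fineK muSfin) inver gt_eqF// lee_pdivrMl// -EFinM => uaM.
have mua : mu_measurable mu S (fun x => u x - a%:E).
  exact: emeasurable_funB.
have iua : (cara mu).-integrable S (fun x => u x - a%:E).
  by apply/integrableP; split => //; apply: le_lt_trans uaM _; rewrite ltry.
have ia : (cara mu).-integrable S (cst a%:E).
  apply/integrableP; split => //.
  by rewrite [X in X < _](integral_cst (cara mu) mS `|a%:E|) lte_mul_pinfty.
have uE : \int[cara mu]_(x in S) u x =
    \int[cara mu]_(x in S) (u x - a%:E) + a%:E * mu S.
  rewrite -(integral_cst (cara mu) mS) -integralD//.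
  by apply: eq_integral => x _; rewrite subeK.
have uafin := integrable_fin_num mS iua.
have : `|\int[cara mu]_(x in S) (u x - a%:E)| <= (fine (mu S) * M)%:E.
  by apply: le_trans uaM; apply: le_abse_integral.
rewrite uE -(fineK uafin) -(fineK muSfin); set i := fine (\int[_]_(_ in _) _).
rewrite lee_fin => iM; exists ((fine (mu S))^-1 * (i + a * fine (mu S)))%R => //.
have -> : ((fine (mu S))^-1 * (i + a * fine (mu S)) - a =
    (fine (mu S))^-1 * i)%R by field; rewrite gt_eqF.
by rewrite normrM gtr0_norm ?invr_gt0// ler_pdivrMl.
Qed.

End averages.

(** * The three regimes *)

Section energy_root.
Context {R : realType}.
Implicit Types (p k b r s : R) (I y : \bar R).

(** Letting [A] decrease to [I^(1/p)]; the infinite case is immediate from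
[k > 0], and the case [I = 0] is the reason for not taking [A = I^(1/p)]. *)
Lemma le_energy_root p k I y : 0 < p -> 0 < k -> (0 <= I)%E ->
  (forall A, 0 < A -> (I <= (A `^ p)%:E)%E -> (y <= (k * A)%:E)%E) ->
  (y <= k%:E * I `^ p^-1)%E.
Proof.
move=> p0 k0; case: I => [i||]// i0 yA; last first.
  by rewrite poweRyr ?invr_neq0 ?gt_eqF// gt0_muley ?lte_fin// leey.
rewrite lee_fin in i0; rewrite poweR_EFin -EFinM.
apply/lee_addgt0Pr => e e0.
have r0 := powR_ge0 i p^-1.
have re0 : 0 < i `^ p^-1 + e / k by rewrite ltr_wpDl// divr_gt0.
have := yA _ re0; rewrite mulrDr [k * (e / k)]mulrC divfK ?gt_eqF// EFinD; apply.
rewrite lee_fin -{1}[i]powRr1// -(mulVf (lt0r_neq0 p0)) powRrM.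
apply: ge0_ler_powR; rewrite ?nnegrE ?(ltW p0) ?(ltW re0)//.
by rewrite lerDl ltW// divr_gt0.
Qed.

(** The dependence of the oscillation scale on the radius, which is also the
Hoelder modulus in the supercritical regime. *)
Lemma radius_scale p s Q b r : 0 < b -> 0 < r ->
  (b * r `^ Q) `^ (- p^-1) * r `^ s = b `^ (- p^-1) * r `^ (s - Q / p).
Proof.
move=> b0 r0; rewrite powRM ?powR_ge0 ?(ltW b0)// -powRrM -mulrA -powRD.
  by rewrite mulrN addrC.
by rewrite (gt_eqF r0) implybT.
Qed.

End energy_root.

Lemma abundant_sublevelsS (R : realType) (X : metricType R) (b Q A p : R)
    (B B' D : set X) (h : X -> R) :
  B' `<=` B -> abundant_sublevels b Q A p B D h ->
  abundant_sublevels b Q A p B' (D `&` B') h.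
Proof.
move=> BB abD x r t r0 t0 xB' Atr.
have [y [Dy xy hy]] := abD x r t r0 t0 (subset_trans xB' BB) Atr.
by exists y; split => //; split => //; exact: xB'.
Qed.

(** In this section [N] is an exceptional set, [A^p] bounds the energy, [K] is
the scale of the oscillation and [c] the coefficient for which
[(2 h / T)^p = c W]. *)
Section regimes.
Context {R : realType} {X : pointedMetricType R}
  {mu : {outer_measure set X -> \bar R}} (p q s Q r0 b : R) (x0 : X)
  (u : X -> \bar R) (g : int -> X -> \bar R) (N : set X).
Hypotheses (p0 : 0 < p) (s0 : 0 < s) (Q0 : 0 < Q) (b0 : 0 < b)
  (r00 : 0 < r0).
Local Notation B0 := (ball x0 r0).
Local Notation BB0 := (ball x0 (2 * r0)).
Local Notation W := (lq_density p q g).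
Local Notation h := (gradient_height p q g).
Local Notation v := (fine \o u).
Local Open Scope ereal_scope.
Hypothesis mmu : metric_measure_space mu.
Hypothesis low : forall (x : X) (r : R), (0 < r)%R -> ball x r `<=` BB0 ->
  (b * r `^ Q)%:E <= mu (ball x r).
Hypothesis mu_u : mu_measurable mu BB0 u.
Hypothesis mg : forall k, mu_measurable mu BB0 (g k).
Hypothesis N0 : mu N = 0.
Hypothesis ufin : forall x, BB0 x -> ~ N x -> u x \is a fin_num.
Hypothesis Wfin : forall x, BB0 x -> ~ N x -> W x \is a fin_num.
Hypothesis grad : pointwise_gradient s (BB0 `\` N) v h.

Lemma inner_ball_sub : B0 `<=` BB0.
Proof. by apply: le_ball; rewrite ler_peMl ?(ltW r00) ?ler1n. Qed.

Lemma measurable_inner_ball : mu.-cara.-measurable B0.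
Proof. exact: measurable_metric_ball. Qed.

Lemma measurable_outer_ball : mu.-cara.-measurable BB0.
Proof. exact: measurable_metric_ball. Qed.

Lemma inner_mass : 0 < mu B0 < +oo. Proof. exact: mmu.2. Qed.

Lemma measurable_u_inner_ball : mu_measurable mu B0 u.
Proof.
by apply: measurable_funS mu_u; [exact: measurable_outer_ball|exact: inner_ball_sub].
Qed.

Context (A : R).
Hypothesis A0 : (0 < A)%R.
Hypothesis WA : \int[cara mu]_(x in BB0) W x <= (A `^ p)%:E.

Local Notation T := (base_height p Q b r0 A).
Local Notation K := (T * r0 `^ s)%R.
Local Notation c := ((2 / T) `^ p)%R.

Lemma abundant_outer_ball : abundant_sublevels b Q A p BB0 (BB0 `\` N) h.
Proof.
by apply: (chebyshev_abundant (mu := mu)) => //; exact: measurable_outer_ball.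
Qed.

Lemma regular_points_sub : BB0 `\` N `<=` BB0. Proof. by move=> x []. Qed.

Lemma oscillation_scale_gt0 : (0 < K)%R.
Proof. by rewrite mulr_gt0 ?powR_gt0//; exact: base_height_gt0. Qed.

Lemma weight_heightE x : (BB0 `\` N) x ->
  (1 + (2 * h x / T) `^ p)%:E = 1 + c%:E * W x.
Proof.
move=> [Bx Nx]; have T0 := base_height_gt0 p0 Q0 b0 r00 A0.
rewrite EFinD; congr (_ + _); rewrite mulrAC powRM ?divr_ge0 ?(ltW T0)//.
  by rewrite gradient_height_powR// EFinM fineK//; exact: Wfin.
exact: gradient_height_ge0.
Qed.

(** This is where the choice of the base height meets the lower mass bound: the
left-hand side is [b r^Q], where [r <= r0] is the first step radius. *)
Lemma weight_mass : (c * A `^ p)%:E <= mu B0.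
Proof.
have T0 := base_height_gt0 p0 Q0 b0 r00 A0.
apply: le_trans (low r00 inner_ball_sub); rewrite lee_fin.
rewrite -powRM ?divr_ge0 ?(ltW T0) ?(ltW A0)// -mulrA [(T^-1 * A)%R]mulrC.
rewrite powRM ?divr_ge0 ?(ltW T0) ?(ltW A0)// base_height_mass//.
rewrite mulrA -powRM ?invr_ge0// divff// powR1 mul1r.
rewrite ler_wpM2l ?(ltW b0)//.
have d1 := chain_ratio_lt1 p0 Q0; have d0 := chain_ratio_gt0 p Q.
apply: ge0_ler_powR; rewrite ?nnegrE ?(ltW Q0) ?(ltW r00)//.
  by rewrite mulr_ge0 ?(ltW r00)// subr_ge0 ltW.
by rewrite ler_piMl ?(ltW r00)// gerBl ltW.
Qed.

Lemma average_le_weight (f : X -> \bar R) (M : R) :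
  mu_measurable mu B0 f -> (forall x, B0 x -> 0 <= f x) -> (0 <= M)%R ->
  (forall x, B0 x -> ~ N x -> f x <= (M * (1 + (2 * h x / T) `^ p))%:E) ->
  average mu B0 f <= (2 * M)%:E.
Proof.
move=> mf f0 M0 fM.
apply: (average_le_density measurable_outer_ball measurable_inner_ball
  inner_ball_sub inner_mass mf (measurable_lq_density p q mg)
  f0 _ WA _ M0 weight_mass).
- by move=> x _; exact: lq_density_ge0.
- exact: powR_ge0.
- apply: (ae_outside N0) => x Nx Bx; apply: le_trans (fM x Bx Nx) _.
  by rewrite EFinM weight_heightE//; split => //; exact: inner_ball_sub.
Qed.

Lemma fine_distance x (a : R) : B0 x -> ~ N x ->
  `|u x - a%:E| = `|v x - a|%:E.
Proof. by move=> Bx Nx; rewrite -(fineK (ufin (inner_ball_sub Bx) Nx)). Qed.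

Lemma measurable_distance (a : \bar R) : mu_measurable mu B0 (fun x => `|u x - a|).
Proof.
by apply: measurableT_comp => //; apply: emeasurable_funB measurable_u_inner_ball _.
Qed.

(** The real [e] is left free for two uses: [e = a] gives the Sobolev
inequality, [e = 0] the membership in the Lebesgue space. *)
Lemma subcritical_average : (s * p < Q)%R -> exists a : R, forall e : R,
  average mu B0 (fun x => `|u x - e%:E| `^ (Q * p / (Q - s * p))) <=
  (2 * (K * oscillation_factor p s Q + `|a - e|) `^ (Q * p / (Q - s * p)))%:E.
Proof.
move=> sp; set ps := (Q * p / (Q - s * p))%R.
have ps0 : (0 < ps)%R by rewrite divr_gt0 ?mulr_gt0 ?subr_gt0.
have [a ua] := subcritical_oscillation p0 s0 Q0 b0 r00 A0 grad abundant_outer_ball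
  regular_points_sub (fun x _ => gradient_height_ge0 p q g x) sp.
have Kc0 : (0 <= K * oscillation_factor p s Q)%R.
  by rewrite mulr_ge0 ?(ltW oscillation_scale_gt0)// addr_ge0 ?mulr_ge0 ?powR_ge0.
exists a => e; apply: average_le_weight.
- apply: (measurableT_comp (measurable_poweR _)); exact: measurable_distance.
- by move=> x _; exact: poweR_ge0.
- exact: powR_ge0.
- move=> x Bx Nx; rewrite fine_distance// poweR_EFin lee_fin.
  have [n [n1 uan np]] := ua x (conj (inner_ball_sub Bx) Nx) Bx.
  apply: le_trans (ler_wpM2l (powR_ge0 _ _) np).
  rewrite -powRM ?(le_trans ler01 n1) ?addr_ge0//.
  apply: ge0_ler_powR; rewrite ?nnegrE ?(ltW ps0)//.
    by rewrite mulr_ge0 ?addr_ge0// (le_trans ler01 n1).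
  apply: le_trans (ler_distD a _ _) _; rewrite mulrDl lerD//.
  by rewrite ler_peMr.
Qed.

Lemma supercritical_average : (Q < s * p)%R -> exists a m : R,
  [/\ average mu B0 u = m%:E,
    (`|m - a| <= 2 * (K * oscillation_factor p s Q))%R &
    forall x, B0 x -> ~ N x -> (`|v x - a| <= K * oscillation_factor p s Q)%R].
Proof.
move=> sp.
have [a ua] := supercritical_oscillation p0 s0 Q0 b0 r00 A0 grad abundant_outer_ball
  regular_points_sub (fun x _ => gradient_height_ge0 p q g x) sp.
have Kc0 : (0 <= K * oscillation_factor p s Q)%R.
  by rewrite mulr_ge0 ?(ltW oscillation_scale_gt0)// addr_ge0 ?mulr_ge0 ?powR_ge0.
have uaB x : B0 x -> ~ N x -> (`|v x - a| <= K * oscillation_factor p s Q)%R.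
  by move=> Bx Nx; apply: ua => //; split => //; exact: inner_ball_sub.
have [m um ma] : exists2 m : R, average mu B0 u = m%:E &
    (`|m - a| <= 2 * (K * oscillation_factor p s Q))%R.
  apply: average_near measurable_inner_ball inner_mass measurable_u_inner_ball _.
  apply: average_le_weight => //.
    exact: measurable_distance.
  move=> x Bx Nx; rewrite fine_distance// lee_fin.
  by apply: le_trans (uaB x Bx Nx) _; rewrite ler_peMr// lerDl powR_ge0.
by exists a, m.
Qed.

Local Notation lam := (p * ln 2 / 3)%R.
Local Notation M0 := (expR (lam * (2 * 4 `^ s)))%R.

(** As [t <= exp t], the exponential bound also bounds the average of [|u - a|],
hence [|m - a|]; passing from [a] to the mean costs the factor
[exp (2 M0)]. *)
Lemma critical_average : (s * p = Q)%R -> exists2 m : R,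
  average mu B0 u = m%:E &
  average mu B0 (fun x => expeR ((lam / K)%:E * `|u x - m%:E|)) <=
  (2 * (expR (2 * M0) * M0))%:E.
Proof.
move=> sp.
have [a ua] := critical_oscillation p0 s0 Q0 b0 r00 A0 grad abundant_outer_ball
  regular_points_sub (fun x _ => gradient_height_ge0 p q g x) sp.
have l0 : (0 < lam / K)%R.
  by rewrite divr_gt0 ?oscillation_scale_gt0// !mulr_gt0// ?ln_gt0 ?ltr1n
    ?invr_gt0.
have uaB x : B0 x -> ~ N x ->
    (expR (lam / K * `|v x - a|) <= M0 * (1 + (2 * h x / T) `^ p))%R.
  by move=> Bx Nx; rewrite mulrAC -mulrA; apply: ua => //; split => //;
     exact: inner_ball_sub.
have [m um ma] : exists2 m : R, average mu B0 u = m%:E &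
    (`|m - a| <= 2 * ((lam / K)^-1 * M0))%R.
  apply: average_near measurable_inner_ball inner_mass measurable_u_inner_ball _.
  apply: average_le_weight.
  - exact: measurable_distance.
  - by [].
  - by rewrite mulr_ge0 ?expR_ge0// invr_ge0 ltW.
  - move=> x Bx Nx; rewrite fine_distance// lee_fin -[leRHS]mulrA ler_pdivlMl//.
    apply: le_trans (uaB x Bx Nx); apply: le_trans (expR_ge1Dx _).
    by rewrite lerDr.
exists m => //; apply: average_le_weight.
- apply: (measurableT_comp (@measurable_expeR R)); apply: measurable_funeM.
  exact: measurable_distance.
- by move=> x _; exact: expeR_ge0.
- by rewrite mulr_ge0 ?expR_ge0.
- move=> x Bx Nx; rewrite fine_distance// lee_fin.
  rewrite -[leRHS]mulrA; apply: le_trans (ler_wpM2l (expR_ge0 _) (uaB x Bx Nx)).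
  rewrite -expRD ler_expR.
  have : (lam / K * `|m - a| <= 2 * M0)%R.
    by rewrite -ler_pdivlMl// mulrCA.
  have : (lam / K * `|v x - m| <= lam / K * (`|v x - a| + `|m - a|))%R.
    by rewrite ler_pM2l// [`|m - a|%R]distrC ler_distD.
  by rewrite mulrDr; lra.
Qed.

End regimes.

(** * The embeddings *)

Section embeddings.
Context {R : realType} {X : pointedMetricType R}
  {mu : {outer_measure set X -> \bar R}} (p q s Q r0 b : R) (x0 : X)
  (u : X -> \bar R) (g : int -> X -> \bar R).
Hypotheses (p0 : 0 < p) (q0 : 0 < q) (s0 : 0 < s) (Q0 : 0 < Q) (b0 : 0 < b)
  (r00 : 0 < r0).
Local Notation B0 := (ball x0 r0).
Local Notation BB0 := (ball x0 (2 * r0)).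
Local Open Scope ereal_scope.
Hypothesis mmu : metric_measure_space mu.
Hypothesis low : forall (x : X) (r : R), (0 < r)%R -> ball x r `<=` BB0 ->
  (b * r `^ Q)%:E <= mu (ball x r).
Hypothesis mu_u : mu_measurable mu BB0 u.
Hypothesis ufin : {ae cara mu, forall x, BB0 x -> u x \is a fin_num}.
Hypothesis gradu : fractional_gradients mu s BB0 u g.
Local Notation energy := (\int[cara mu]_(x in BB0) lq_density p q g x).
Local Notation avg_g := (average mu BB0 (lq_density p q g)).

Lemma outer_mass : 0 < mu BB0 < +oo.
Proof. by apply: mmu.2; rewrite mulr_gt0. Qed.

Lemma outer_mass_fin_num : mu BB0 \is a fin_num.
Proof. by have /andP[m0 moo] := outer_mass; rewrite ge0_fin_numE// ltW. Qed.

Lemma fine_outer_mass_gt0 : (0 < fine (mu BB0))%R.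
Proof. exact: fine_gt0 outer_mass. Qed.

Lemma energy_ge0 : 0 <= energy.
Proof. by apply: integral_ge0 => x _; exact: lq_density_ge0. Qed.

Lemma average_energyE :
  avg_g `^ p^-1 = (fine (mu BB0) `^ (- p^-1))%:E * energy `^ p^-1.
Proof.
rewrite /average -(fineK outer_mass_fin_num) inver gt_eqF ?fine_outer_mass_gt0//.
rewrite poweRM ?energy_ge0 ?lee_fin ?invr_ge0 ?(ltW fine_outer_mass_gt0)//.
by rewrite poweR_EFin powRV ?(ltW fine_outer_mass_gt0).
Qed.

(** The mass of the doubled ball cancels, and what remains is the energy times
the scale of the oscillation. *)
Lemma normalized_energyE (k : R) :
  k%:E * (mu BB0 / (b * r0 `^ Q)%:E) `^ p^-1 * (r0 `^ s)%:E * avg_g `^ p^-1 =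
  (k * ((b * r0 `^ Q) `^ (- p^-1) * r0 `^ s))%:E * energy `^ p^-1.
Proof.
have bQ : (0 < b * r0 `^ Q)%R by rewrite mulr_gt0 ?powR_gt0.
have bV : (0 <= (b * r0 `^ Q)^-1)%R by rewrite invr_ge0 ltW.
have m0 := fine_outer_mass_gt0.
rewrite average_energyE muleA; congr (_ * _).
rewrite -[X in (X / _) `^ _](fineK outer_mass_fin_num) inver (gt_eqF bQ).
rewrite -(EFinM (fine _)) poweR_EFin.
rewrite -!EFinM; congr EFin; rewrite (powRM _ (ltW m0) bV).
rewrite (powRV _ (ltW bQ)).
rewrite [(fine _ `^ (- _))%R]powRN; field.
by rewrite gt_eqF// powR_gt0.
Qed.

Lemma gradient_exceptional_set : energy < +oo -> exists N : set X, [/\ mu N = 0,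
    forall x, BB0 x -> ~ N x -> u x \is a fin_num,
    forall x, BB0 x -> ~ N x -> lq_density p q g x \is a fin_num &
    pointwise_gradient s (BB0 `\` N) (fine \o u) (gradient_height p q g)].
Proof. by apply: exceptional_set => //; exact: measurable_metric_ball. Qed.

Lemma energy_bounded (A : R) : energy <= (A `^ p)%:E -> energy < +oo.
Proof. by move=> /le_lt_trans; apply; rewrite ltry. Qed.

Local Notation kappa := (scale_factor p Q * oscillation_factor p s Q)%R.

Lemma kappa_gt0 : (0 < kappa)%R.
Proof.
have d1 := chain_ratio_lt1 p0 Q0.
by rewrite !mulr_gt0 ?powR_gt0 ?subr_gt0// ltr_wpDr// ?mulr_gt0 ?powR_gt0.
Qed.

Lemma energy_rate_gt0 (k : R) : (0 < k)%R ->
  (0 < k * kappa * ((b * r0 `^ Q) `^ (- p^-1) * r0 `^ s))%R.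
Proof.
move=> k0; apply: mulr_gt0; first exact: mulr_gt0 k0 kappa_gt0.
by rewrite mulr_gt0 ?powR_gt0// mulr_gt0 ?powR_gt0.
Qed.

Lemma subcritical_membership : (0 < s * p < Q)%R -> energy < +oo ->
  LspaceS mu (Q * p / (Q - s * p))%:E B0 u.
Proof.
move=> /andP[sp0 sp] Ifin; set ps := (Q * p / (Q - s * p))%R.
have ps0 : (0 < ps)%R by rewrite divr_gt0 ?mulr_gt0 ?subr_gt0.
have [N [N0 uN WN grad]] := gradient_exceptional_set Ifin.
split; first exact: (measurable_u_inner_ball r00 mmu mu_u).
rewrite LnormS_integral ?gt_eqF//; apply: poweR_lty.
have Ifn : energy \is a fin_num by rewrite ge0_fin_numE// energy_ge0.
pose A := ((fine energy + 1) `^ p^-1)%R.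
have I1 : (0 < fine energy + 1)%R by rewrite ltr_wpDl// fine_ge0// energy_ge0.
have A0 : (0 < A)%R by exact: powR_gt0.
have WA : energy <= (A `^ p)%:E.
  rewrite -powRrM mulVf ?gt_eqF// powRr1 ?(ltW I1)// -[leLHS](fineK Ifn).
  by rewrite lee_fin lerDl.
have [mg _ _] := gradu.
have [a /(_ 0%R) ua] := subcritical_average p0 s0 Q0 b0 r00 mmu low mu_u mg
  N0 uN WN grad A0 WA sp.
have /andP[m0 moo] := inner_mass x0 r00 mmu.
have mfin : mu B0 \is a fin_num by rewrite ge0_fin_numE// ltW.
have mf : (0 < fine (mu B0))%R by rewrite fine_gt0// m0.
move: ua; rewrite /average -(fineK mfin) inver gt_eqF// lee_pdivrMl// => ua.
under eq_integral do rewrite -[u _]sube0.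
by apply: le_lt_trans ua _; rewrite -EFinM ltry.
Qed.

Lemma subcritical_embedding : (0 < s * p < Q)%R ->
  let pstar := (Q * p / (Q - s * p))%R in
  ereal_inf [set (average mu B0 (fun x => `|u x - a%:E| `^ pstar))
                   `^ pstar^-1 | a in [set: R]]
  <= (2 `^ pstar^-1 * kappa)%:E * (mu BB0 / (b * r0 `^ Q)%:E) `^ p^-1
       * (r0 `^ s)%:E * avg_g `^ p^-1.
Proof.
move=> /andP[sp0 sp] /=; set ps := (Q * p / (Q - s * p))%R.
have ps0 : (0 < ps)%R by rewrite divr_gt0 ?mulr_gt0 ?subr_gt0.
rewrite normalized_energyE; apply: le_energy_root => //.
- by apply: energy_rate_gt0; rewrite ?powR_gt0.
- exact: energy_ge0.
move=> A A0 WA.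
have [N [N0 uN WN grad]] := gradient_exceptional_set (energy_bounded WA).
have [mg _ _] := gradu.
have [a /(_ a)] := subcritical_average p0 s0 Q0 b0 r00 mmu low mu_u mg
  N0 uN WN grad A0 WA sp.
rewrite -/ps subrr normr0 addr0 => ua.
apply: (@le_trans _ _ (average mu B0 (fun x => `|u x - a%:E| `^ ps) `^ ps^-1)).
  by apply: ereal_inf_lbound; exists a.
have avg0 : 0 <= average mu B0 (fun x => `|u x - a%:E| `^ ps).
  rewrite mule_ge0 ?inve_ge0 ?outer_measure_ge0//.
  by apply: integral_ge0 => x _; exact: poweR_ge0.
have K0 : (0 <= base_height p Q b r0 A * r0 `^ s * oscillation_factor p s Q)%R.
  by rewrite mulr_ge0 ?(ltW (oscillation_scale_gt0 s p0 Q0 b0 r00 A0))// addr_ge0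
    ?mulr_ge0 ?powR_ge0.
apply: le_trans (gt0_ler_poweR _ _ _ ua) _; rewrite ?invr_ge0 ?(ltW ps0)//.
- by rewrite in_itv/= avg0 leey.
- by rewrite in_itv/= leey lee_fin mulr_ge0 ?powR_ge0.
rewrite poweR_EFin lee_fin powRM ?powR_ge0// -powRrM divff ?gt_eqF// powRr1//.
by rewrite base_height_scale// le_eqVlt; apply/orP; left; apply/eqP; ring.
Qed.

Local Notation lam := (p * ln 2 / 3)%R.
Local Notation M0 := (expR (lam * (2 * 4 `^ s)))%R.

Lemma average_one (f : X -> \bar R) : mu_measurable mu B0 f ->
  (forall x, B0 x -> 0 <= f x) -> {ae cara mu, forall x, B0 x -> f x = 1} ->
  average mu B0 f <= 2%:E.
Proof.
move=> mf f0 f1; rewrite -[2%R]mulr1.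
apply: (@average_le_density _ _ _ B0 B0 f (cst 0) 0 0 1) => //.
- exact: measurable_metric_ball.
- exact: measurable_metric_ball.
- exact: mmu.2.
- exact: measurable_cst.
- by rewrite integral0.
- by rewrite mul0r outer_measure_ge0.
- have [N [_ N0 f1N]] := f1; apply: (ae_outside N0) => x Nx Bx.
  rewrite mule0 adde0 mule1 le_eqVlt; apply/orP; left; apply/eqP.
  by apply: contrapT => fx; apply: Nx; apply: f1N => /(_ Bx).
Qed.

(** In the exponential inequality the norm is a divisor, and [0^-1 = +oo] in the
extended reals; the quotient is harmless only because [u] then equals its
average almost everywhere. *)
Lemma zero_energy : energy = 0 -> exists N (m : R), [/\ mu N = 0,
  average mu B0 u = m%:E & forall x, B0 x -> ~ N x -> u x = m%:E].
Proof.
move=> I0; have Ifin : energy < +oo by rewrite I0.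
have [N [N0 uN WN grad]] := gradient_exceptional_set Ifin.
have mBB := measurable_metric_ball x0 (2 * r0) mmu.
have mB := measurable_metric_ball x0 r0 mmu.
have [mg _ _] := gradu.
have mW := measurable_lq_density p q mg.
have BBB : B0 `<=` BB0 by exact: inner_ball_sub.
have [N2 [mN2 N20 WN2]] : {ae cara mu, forall x, BB0 x -> lq_density p q g x = 0}.
  apply/(ae_eq_integral_abs _ mBB mW); rewrite -[RHS]I0.
  by apply: eq_integral => x _; rewrite gee0_abs ?lq_density_ge0.
have W0 x : BB0 x -> ~ N2 x -> gradient_height p q g x = 0%R.
  move=> Bx Nx; rewrite /gradient_height.
  have -> : lq_density p q g x = 0.
    by apply: contrapT => Wx; apply: Nx; apply: WN2 => /(_ Bx).
  by rewrite poweR0r// invr_neq0 ?gt_eqF.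
(* The default value x0 is used only if B0 is exceptional as a whole, and then
   nothing is claimed. *)
pose a := fine (u (xget x0 (B0 `\` (N `|` N2)))).
have ua x : B0 x -> ~ (N `|` N2) x -> u x = a%:E.
  move=> Bx Nx; have [By Ny] : (B0 `\` (N `|` N2)) (xget x0 (B0 `\` (N `|` N2))).
    by apply: (@xgetPex _ x0); exists x.
  have ND z : B0 z -> ~ (N `|` N2) z -> [/\ BB0 z, ~ N z & ~ N2 z].
    by move=> Bz Nz; split; [exact: BBB|by move=> ?; apply: Nz; left|
      by move=> ?; apply: Nz; right].
  have [Bx' Nx1 Nx2] := ND x Bx Nx; have [By' Ny1 Ny2] := ND _ By Ny.
  have := grad _ _ (conj Bx' Nx1) (conj By' Ny1).
  rewrite !W0// addr0 mulr0 normr_le0 subr_eq0 /= => /eqP uxa.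
  by rewrite -(fineK (uN x Bx' Nx1)) uxa.
have N'0 : mu (N `|` N2) = 0 by exact: null_setU.
have [m um ma] : exists2 m : R, average mu B0 u = m%:E & (`|m - a| <= 2 * 0)%R.
  apply: (average_near mB (mmu.2 _ _ r00) (measurable_u_inner_ball r00 mmu mu_u)).
  apply: (@average_le_density _ _ _ B0 B0 _ (cst 0) 0 0 0) => //.
  - exact: mmu.2.
  - exact: (measurable_distance r00 mmu mu_u).
  - exact: measurable_cst.
  - by rewrite integral0.
  - by rewrite mul0r outer_measure_ge0.
  - apply: (ae_outside N'0) => x Nx Bx.
    by rewrite ua// subee// abse0 mul0e.
exists (N `|` N2), m; split => // x Bx Nx.
rewrite ua//; congr EFin; apply/eqP; rewrite eq_sym -subr_eq0 -normr_le0.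
by rewrite mulr0 in ma.
Qed.

Lemma critical_embedding : (s * p)%R = Q ->
  average mu B0 (fun x =>
    expeR ((lam / scale_factor p Q * b `^ (p^-1 - Q^-1) * b `^ Q^-1)%:E *
      (`|u x - average mu B0 u| / Llq_norm mu p q BB0 g)))
  <= (2 * (expR (2 * M0) * M0))%:E.
Proof.
move=> sp; have [mg g0 _] := gradu; rewrite Llq_norm_density//.
have l2 : (0 < ln 2 :> R)%R by rewrite ln_gt0 ?ltr1n.
have C2 : 2%:E <= (2 * (expR (2 * M0) * M0))%:E.
  have e1 t : (0 <= t)%R -> (1 <= expR t :> R)%R.
    by move=> t0; rewrite -[leLHS]expR0 ler_expR.
  have M1 : (1 <= M0)%R by rewrite e1// !mulr_ge0 ?powR_ge0// ltW.
  by rewrite lee_fin ler_peMr// mulr_ege1// e1// mulr_ge0 ?expR_ge0.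
have mB := measurable_metric_ball x0 r0 mmu.
(* An infinite norm makes the exponent 0, as +oo^-1 = 0. *)
have [Ioo|Ifin] := eqVneq energy +oo.
  rewrite Ioo poweRyr ?invr_neq0 ?gt_eqF// invey; apply: le_trans C2.
  under eq_fun do rewrite !mule0 expeR0.
  apply: average_one => [|x _|]; [exact: measurable_cst|by []|].
  by apply: (ae_outside (outer_measure0 mu)).
have {}Ifin : energy < +oo by rewrite ltey.
have [I0|I0] := eqVneq energy 0.
  have [N [m [N0 um uN]]] := zero_energy I0.
  rewrite I0 poweR0r ?invr_neq0 ?gt_eqF// inve0 um; apply: le_trans C2.
  apply: average_one => [|x _|].
  - apply: (measurableT_comp (@measurable_expeR R)); apply: measurable_funeM.
    apply: emeasurable_funM => //; exact: (measurable_distance r00 mmu mu_u).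
  - exact: expeR_ge0.
  - apply: (ae_outside N0) => x Nx Bx.
    by rewrite (uN x Bx Nx) subee// abse0 mul0e mule0 expeR0.
have [N [N0 uN WN grad]] := gradient_exceptional_set Ifin.
have Ifn : energy \is a fin_num by rewrite ge0_fin_numE// energy_ge0.
pose A := (fine energy `^ p^-1)%R.
have I1 : (0 < fine energy)%R by rewrite fine_gt0// Ifin andbT lt0e I0 energy_ge0.
have A0 : (0 < A)%R by exact: powR_gt0.
have WA : energy <= (A `^ p)%:E.
  by rewrite -powRrM mulVf ?gt_eqF// powRr1 ?(ltW I1)// fineK.
have [m um um2] := critical_average p0 s0 Q0 b0 r00 mmu low mu_u mg
  N0 uN WN grad A0 WA sp.
apply: le_trans um2; rewrite um le_eqVlt; apply/orP; left; apply/eqP.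
congr (average mu B0); apply/funext => x; congr expeR.
rewrite -(fineK Ifn) poweR_EFin -/A inver gt_eqF// muleCA muleC -EFinM.
congr (_%:E * _); rewrite base_height_scale// -[(_ * r0 `^ s)%R]mulrA.
rewrite radius_scale//.
have -> : (s - Q / p = 0)%R by rewrite -sp mulfK ?gt_eqF// subrr.
rewrite powRr0 mulr1.
rewrite -[(_ / _ * _ * b `^ Q^-1)%R]mulrA -powRD ?(gt_eqF b0) ?implybT//.
have d1 := chain_ratio_lt1 p0 Q0.
rewrite subrK powRN; field.
by rewrite !gt_eqF ?powR_gt0// mulr_gt0 ?powR_gt0 ?subr_gt0.
Qed.

Lemma supercritical_embedding : (Q < s * p)%R ->
  LnormS mu +oo B0 (fun x => u x - average mu B0 u)
  <= (3 * kappa)%:E * (mu BB0 / (b * r0 `^ Q)%:E) `^ p^-1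
       * (r0 `^ s)%:E * avg_g `^ p^-1.
Proof.
move=> sp; have [mg _ _] := gradu; have BBB : B0 `<=` BB0 by exact: inner_ball_sub.
rewrite normalized_energyE; apply: le_energy_root => //.
- by apply: energy_rate_gt0; rewrite ?powR_gt0.
- exact: energy_ge0.
move=> A A0 WA.
have [N [N0 uN WN grad]] := gradient_exceptional_set (energy_bounded WA).
have [a [m [um ma ua]]] := supercritical_average p0 s0 Q0 b0 r00 mmu low mu_u
  mg N0 uN WN grad A0 WA sp.
set k := (base_height p Q b r0 A * r0 `^ s * oscillation_factor p s Q)%R
  in ma ua.
have k0 : (0 <= k)%R.
  by rewrite mulr_ge0 ?(ltW (oscillation_scale_gt0 s p0 Q0 b0 r00 A0))// addr_ge0
    ?mulr_ge0 ?powR_ge0.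
have -> : (3 * kappa * ((b * r0 `^ Q) `^ (- p^-1) * r0 `^ s) * A = 3 * k)%R.
  by rewrite /k base_height_scale//; ring.
have k3 : (0 <= 3 * k)%R by rewrite mulr_ge0.
rewrite /LnormS unlock; case: ifP => _; last by rewrite lee_fin.
apply/ess_supP; apply: (ae_outside N0) => x Nx; rewrite /= patchE.
case: ifPn => [/set_mem Bx|_]; last by rewrite abse0 lee_fin.
rewrite um -(fineK (uN x (BBB x Bx) Nx)) lee_fin.
apply: le_trans (ler_distD a _ _) _; rewrite [`|a - m|%R]distrC.
by have := ua x Bx Nx; move: ma => /=; lra.
Qed.

(** The oscillation bound on a smaller ball, with the same exceptional set and
the same energy: both hypotheses of the chaining argument restrict. *)
Lemma supercritical_ball (x1 : X) (r1 A : R) (N : set X) :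
  (0 < r1)%R -> ball x1 (2 * r1) `<=` BB0 -> (0 < A)%R ->
  energy <= (A `^ p)%:E -> (Q < s * p)%R -> mu N = 0 ->
  (forall x, BB0 x -> ~ N x -> lq_density p q g x \is a fin_num) ->
  pointwise_gradient s (BB0 `\` N) (fine \o u) (gradient_height p q g) ->
  forall x y, ball x1 r1 x -> ball x1 r1 y -> ~ N x -> ~ N y ->
  (`|fine (u x) - fine (u y)| <=
   2 * kappa * (b `^ (- p^-1) * r1 `^ (s - Q / p)) * A)%R.
Proof.
move=> r10 B1 A0 WA sp N0 WN grad x y Bx By Nx Ny; have [mg _ _] := gradu.
have ab := abundant_sublevelsS B1 (chebyshev_abundant p0 A0
  (measurable_metric_ball x0 (2 * r0) mmu) mg low N0 WN WA).
have gradB : pointwise_gradient s ((BB0 `\` N) `&` ball x1 (2 * r1))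
    (fine \o u) (gradient_height p q g).
  by move=> ? ? [? _] [? _]; exact: grad.
have subB : (BB0 `\` N) `&` ball x1 (2 * r1) `<=` ball x1 (2 * r1) by move=> ? [].
have [a ua] := supercritical_oscillation p0 s0 Q0 b0 r10 A0 gradB ab
  subB (fun x _ => gradient_height_ge0 p q g x) sp.
have BB1 z : ball x1 r1 z -> ball x1 (2 * r1) z by exact: inner_ball_sub.
have in1 z : ball x1 r1 z -> ~ N z -> ((BB0 `\` N) `&` ball x1 (2 * r1)) z.
  by move=> Bz Nz; split; [split=> //; exact/B1/BB1|exact: BB1].
rewrite -radius_scale//.
have -> : (2 * kappa * ((b * r1 `^ Q) `^ (- p^-1) * r1 `^ s) * A =
  base_height p Q b r1 A * r1 `^ s * oscillation_factor p s Q +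
  base_height p Q b r1 A * r1 `^ s * oscillation_factor p s Q)%R.
  by rewrite base_height_scale//; ring.
apply: le_trans (ler_distD a _ _) _; rewrite [`|a - _|%R]distrC.
by apply: lerD; apply: ua => //; exact: in1.
Qed.

(** A ball of radius [r1 <= 4 d(x,y)] containing both points, whose double lies
in the large ball, is enough; the exponent [s - Q/p] is positive. *)
Lemma supercritical_holder : (Q < s * p)%R ->
  exists2 N : set X, mu N = 0 &
    forall x y : X, (B0 `\` N) x -> (B0 `\` N) y ->
      `|u x - u y| <= (2 * kappa * 4 `^ (s - Q / p) * fine (mu BB0) `^ p^-1
        * b `^ (- p^-1) * mdist x y `^ (s - Q / p))%:E * avg_g `^ p^-1.
Proof.
move=> sp; have BBB : B0 `<=` BB0 by exact: inner_ball_sub.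
have sQ : (0 < s - Q / p)%R by rewrite subr_gt0 ltr_pdivrMr.
pose k d := (2 * kappa * (b `^ (- p^-1) * (4 * d) `^ (s - Q / p)))%R.
have kE d : (0 <= d)%R -> (2 * kappa * 4 `^ (s - Q / p) *
    fine (mu BB0) `^ p^-1 * b `^ (- p^-1) * d `^ (s - Q / p))%:E *
    avg_g `^ p^-1 = (k d)%:E * energy `^ p^-1.
  move=> d0; rewrite average_energyE muleA -EFinM; congr (_%:E * _).
  rewrite /k powRM// [(fine _ `^ (- _))%R]powRN; field.
  by rewrite gt_eqF// powR_gt0 ?fine_outer_mass_gt0.
have [N [N0 uN far]] : exists N : set X, [/\ mu N = 0,
    forall x, BB0 x -> ~ N x -> u x \is a fin_num &
    forall A x y, (0 < A)%R -> energy <= (A `^ p)%:E -> B0 x -> B0 y ->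
      ~ N x -> ~ N y -> x != y ->
      `|u x - u y| <= (k (mdist x y) * A)%:E].
  have [Ioo|Ifin] := eqVneq energy +oo.
    have [N [_ N0 uN]] := ufin; exists N; split => //.
      by move=> x Bx Nx; apply: contrapT => ux; apply: Nx; apply: uN => /(_ Bx).
    by move=> A x y _; rewrite Ioo leNgt ltry.
  have [|N [N0 uN WN grad]] := gradient_exceptional_set; first by rewrite ltey.
  exists N; split => // A x y A0 WA Bx By Nx Ny xy.
  have d0 : (0 < mdist x y)%R by rewrite mdist_gt0.
  rewrite -(fineK (uN x (BBB _ Bx) Nx)) -(fineK (uN y (BBB _ By) Ny)) lee_fin.
  have scale r1 : (0 < r1)%R -> (r1 <= 4 * mdist x y)%R ->
      (2 * kappa * (b `^ (- p^-1) * r1 `^ (s - Q / p)) * A <=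
       k (mdist x y) * A)%R.
    move=> r10 r1d; rewrite ler_wpM2r ?(ltW A0)// ler_wpM2l//.
      by apply: mulr_ge0 => //; exact: ltW kappa_gt0.
    rewrite ler_wpM2l ?powR_ge0//; apply: ge0_ler_powR;
      rewrite ?nnegrE ?(ltW sQ) ?(ltW r10)//.
    by rewrite mulr_ge0 ?(ltW d0).
  have [dr|rd] := leP (4 * mdist x y)%R r0; last first.
    (* The points are far apart, and the fixed ball is small enough. *)
    apply: le_trans (scale r0 r00 (ltW rd)).
    by apply: (@supercritical_ball x0 r0 A N).
  have r10 : (0 < 2 * mdist x y)%R by rewrite mulr_gt0.
  apply: le_trans (scale (2 * mdist x y)%R r10 _); last first.
    by rewrite ler_wpM2r ?(ltW d0)// ler_nat.
  apply: (@supercritical_ball x _ A N) => //.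
  - move=> z; move: Bx; rewrite !ballEmdist/= => xB xz.
    by apply: le_lt_trans (metric_triangle _ x _) _; lra.
  - by rewrite ballEmdist/= mdistxx.
  - by rewrite ballEmdist/= ltr_pMl// ltr1n.
exists N => // x y [Bx Nx] [By Ny]; rewrite kE ?mdist_ge0//.
have [<-|xy] := eqVneq x y.
  rewrite subee ?abse0; last exact: uN (BBB _ Bx) Nx.
  rewrite mule_ge0 ?poweR_ge0// lee_fin; apply: mulr_ge0.
    by apply: mulr_ge0 => //; exact: ltW kappa_gt0.
  by rewrite mulr_ge0 ?powR_ge0.
apply: le_energy_root => //; last by move=> A A0 WA; exact: far.
- apply: mulr_gt0; first by apply: mulr_gt0 => //; exact: kappa_gt0.
  by rewrite mulr_gt0 ?powR_gt0// mulr_gt0// mdist_gt0.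
- exact: energy_ge0.
Qed.

End embeddings.

Local Open Scope ereal_scope.

(* C, C2, C3 depend on p, q, s, Q only; C1 may also depend on b, and the last
   constant c on mu(2B_0). *)
Theorem theorem3p1 (R : realType) (p q s Q : R)
    (p0 : (0 < p)%R) (q0 : (0 < q)%R) (s0 : (0 < s)%R) (Q0 : (0 < Q)%R) :
  exists (C C2 C3 : R) (C1 c : R -> R),
    [/\ (0 < C)%R, (0 < C2)%R, (0 < C3)%R,
        forall t : R, (0 < t)%R -> (0 < C1 t)%R &
        forall t : R, (0 < t)%R -> (0 < c t)%R] /\
    forall (X : pointedMetricType R) (mu : {outer_measure set X -> \bar R})
        (x0 : X) (r0 b : R) (u : X -> \bar R) (g : int -> X -> \bar R),
      let B0 := ball x0 r0 in
      let BB0 := ball x0 (2 * r0)%R in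
      let avg_g := average mu BB0
        (fun x => (\esum_(j in [set: int]) g j x `^ q) `^ (p / q)) in
      let u_B0 := average mu B0 u in
      metric_measure_space mu ->
      (0 < r0)%R ->
      (0 < b)%R ->
      (forall (x : X) (r : R), (0 < r)%R -> ball x r `<=` BB0 ->
        (b * r `^ Q)%:E <= mu (ball x r)) ->
      hajlasz_TL mu s p q BB0 u ->
      {ae cara mu, forall x, BB0 x -> u x \is a fin_num} ->
      fractional_gradients mu s BB0 u g ->
      [/\ (0 < s * p < Q)%R ->
            let pstar := (Q * p / (Q - s * p))%R in
            LspaceS mu pstar%:E B0 u /\
            ereal_inf [set (average mu B0 (fun x => `|u x - a%:E| `^ pstar))
                             `^ pstar^-1 | a in [set: R]]
            <= C%:E * (mu BB0 / (b * r0 `^ Q)%:E) `^ p^-1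
                 * (r0 `^ s)%:E * avg_g `^ p^-1,
          (s * p = Q)%R ->
            average mu B0 (fun x =>
              expeR ((C1 b * b `^ Q^-1)%:E
                     * (`|u x - u_B0| / Llq_norm mu p q BB0 g)))
            <= C2%:E
        & (Q < s * p)%R ->
            LnormS mu +oo B0 (fun x => u x - u_B0)
            <= C3%:E * (mu BB0 / (b * r0 `^ Q)%:E) `^ p^-1
                 * (r0 `^ s)%:E * avg_g `^ p^-1 /\
            exists2 N : set X, mu N = 0 &
              forall x y : X, (B0 `\` N) x -> (B0 `\` N) y ->
                `|u x - u y|
                <= (c (fine (mu BB0)) * b `^ (- p^-1)
                    * mdist x y `^ (s - Q / p))%:E * avg_g `^ p^-1].
Proof.
pose ps := (Q * p / (Q - s * p))%R.
pose kappa := (scale_factor p Q * oscillation_factor p s Q)%R.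
pose lam := (p * ln 2 / 3)%R.
pose M0 := expR (lam * (2 * 4 `^ s)).
have kappa0 : (0 < kappa)%R := kappa_gt0 s p0 Q0.
have scale0 : (0 < scale_factor p Q)%R.
  by rewrite mulr_gt0 ?powR_gt0// subr_gt0 chain_ratio_lt1.
have lam0 : (0 < lam)%R by rewrite divr_gt0 ?mulr_gt0 ?ln_gt0 ?ltr1n.
(* For s p = Q the scale of the oscillation is scale_factor b^(-1/p) A, whence
   the power of b in C1; the factor m^(1/p) in c turns the average of the
   density over 2B_0 back into its integral. *)
exists (2 `^ ps^-1 * kappa)%R, (2 * (expR (2 * M0) * M0))%R, (3 * kappa)%R,
  (fun t => lam / scale_factor p Q * t `^ (p^-1 - Q^-1))%R,
  (fun t => 2 * kappa * 4 `^ (s - Q / p) * t `^ p^-1)%R.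
split.
  split => [||| t t0 | t t0]; first by rewrite mulr_gt0 ?powR_gt0.
  - by rewrite !mulr_gt0 ?expR_gt0.
  - by rewrite mulr_gt0.
  - by rewrite mulr_gt0 ?powR_gt0// divr_gt0.
  - by rewrite mulr_gt0 ?powR_gt0// mulr_gt0 ?powR_gt0// mulr_gt0.
move=> X mu x0 r0 b u g B0 BB0 avg_g u_B0 mmu r00 b0 low [mu_u uTL] ufin gradu.
split=> [sp pstar|sp|sp].
- split; last first.
    exact: (subcritical_embedding p0 q0 s0 Q0 b0 r00 mmu low mu_u ufin gradu sp).
  have [_ [g' gradg' <-]] := ereal_inf_lt uTL.
  have [_ g0 _] := gradg'; rewrite Llq_norm_density// => Ifin.
  apply: (subcritical_membership p0 q0 s0 Q0 b0 r00 mmu low mu_u ufin gradg' sp).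
  by apply: lty_poweRy Ifin; rewrite invr_neq0 ?gt_eqF.
- exact: (critical_embedding p0 q0 s0 Q0 b0 r00 mmu low mu_u ufin gradu sp).
- split.
    exact: (supercritical_embedding p0 q0 s0 Q0 b0 r00 mmu low mu_u ufin gradu sp).
  exact: (supercritical_holder p0 q0 s0 Q0 b0 r00 mmu low ufin gradu sp).
Qed.
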